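(* For any integer $m\ge 1$ and any complex number $t$, $$\operatorname{Res}_x\left(U_m(x)+tU_{m-1}(x),\ \sum_{k=0}^{m-1}U_k(x)\right)=(-1)^{\frac{m(m-1)}{2}}\,t^{\lfloor m/2\rfloor}\,2^{m(m-1)}.$$
   Context: $U_n(x)$ is the $n$-th Chebyshev polynomial of the second kind, defined by $U_n(\cos\theta)=\frac{\sin (n+1)\theta}{\sin\theta}$; equivalently $U_0(x)=1$, $U_1(x)=2x$, $U_{n+1}(x)=2xU_n(x)-U_{n-1}(x)$. For polynomials $f$ of degree $p$ with leading coefficient $a$ and complex roots $\alpha_1,\ldots,\alpha_p$, and $g$ of degree $q$ with leading coefficient $b$ and complex roots $\beta_1,\ldots,\beta_q$ (roots listed with multiplicity), the resultant is $\operatorname{Res}_x(f(x),g(x))=a^{q}b^{p}\prod_{1\le i\le p,\,1\le j\le q}(\alpha_i-\beta_j)$, empty products being $1$. The convention $t^0=1$ is used, including for $t=0$. *)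

(* Defs.v *)
From HB Require Import structures.
From mathcomp Require Import all_boot all_order all_algebra.
From mathcomp Require Import reals complex.

Set Implicit Arguments.
Unset Strict Implicit.
Unset Printing Implicit Defensive.

Import GRing.Theory.
Local Open Scope ring_scope.

Fixpoint chebyshevU (R : nzRingType) (n : nat) {struct n} : {poly R} :=
  match n with
  | 0%N => 1
  | 1%N => 2%:R *: 'X
  | (k.+1 as j).+1 => 2%:R *: 'X * chebyshevU R j - chebyshevU R k
  end.

(* For p = 0 the list is arbitrary. *)
Definition roots_seq (F : closedFieldType) (p : {poly F}) : seq F :=
  sval (closed_field_poly_normal p).

(* MathComp's [resultant f g] is the determinant of a Sylvester matrix whose
   rows list coefficients by increasing degree, which for nonzero f and g
   differs from this resultant by the sign (-1)^(deg f * deg g). *)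
Definition Res (F : closedFieldType) (f g : {poly F}) : F :=
  lead_coef f ^+ (size g).-1 * lead_coef g ^+ (size f).-1 *
  \prod_(a <- roots_seq f) \prod_(b <- roots_seq g) (a - b).

Lemma roots_seqP (F : closedFieldType) (p : {poly F}) :
  p = lead_coef p *: \prod_(z <- roots_seq p) ('X - z%:P).
Proof. exact: svalP (closed_field_poly_normal p). Qed.

Lemma roots_seq_perm (F : closedFieldType) (a : F) (rs : seq F) :
  a != 0 ->
  perm_eq (roots_seq (a *: \prod_(z <- rs) ('X - z%:P))) rs.
Proof.
move=> a0; have := roots_seqP (a *: \prod_(z <- rs) ('X - z%:P)).
rewrite lead_coefZ (monicP (monic_prod_XsubC _ _ _)) mulr1.
by move/(scalerI a0)/esym/prod_XsubC_eq.
Qed.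

Lemma ResE (F : closedFieldType) (a b : F) (rs ss : seq F) :
  a != 0 -> b != 0 ->
  Res (a *: \prod_(z <- rs) ('X - z%:P)) (b *: \prod_(z <- ss) ('X - z%:P)) =
  a ^+ size ss * b ^+ size rs * \prod_(r <- rs) \prod_(s <- ss) (r - s).
Proof.
move=> a0 b0; rewrite /Res !lead_coefZ.
rewrite !(monicP (monic_prod_XsubC _ _ _)) !mulr1 !size_scale //.
rewrite !size_prod_XsubC (perm_big _ (roots_seq_perm rs a0)) /=.
congr (_ * _); apply: eq_bigr => r _.
exact: perm_big (roots_seq_perm ss b0).
Qed.

(* Main.v *)
Require Import Defs.
From mathcomp Require Import all_boot all_order all_algebra.
From mathcomp Require Import reals complex.
From mathcomp Require Import ring.

Import GRing.Theory.
Local Open Scope ring_scope.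
Local Open Scope complex_scope.

(** Write S_m for the sum of U_0, ..., U_{m-1} and f = U_m + t U_{m-1}.  Up to a
    power of the leading coefficient of S_m and a sign, the resultant is the
    product of the values of f at the roots of S_m, and the sign
    (-1)^(m(m-1)) is 1.  These values are constant on the roots of each factor in
      S_{2k+2} = U_k (U_k + U_{k+1}),   S_{2k+3} = U_{k+1} (U_k + U_{k+1}):
    the doubling formulas express f through U_k and U_{k+1}, and the relation
    U_k^2 + U_{k+1}^2 = 1 + 2x U_k U_{k+1} shows that f equals 1 on the roots of
    one factor and -t on those of the other.  The factor that gives -t has
    degree k+1, the integer part of m/2, so the product of the values is
    (-t)^(m/2) with integer division; for m = 1 the sum S_1 = 1 has no roots.
    [Res_mul_const] then yields the formula, as m/2 and m(m-1)/2 have the same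
    parity. *)

(** * Identities between Chebyshev polynomials *)

(* Otherwise [/=] unfolds U_{n+2} by the recurrence. *)
#[local] Arguments chebyshevU : simpl never.

Lemma chebyshevU_rec (R : comNzRingType) (n : nat) :
  chebyshevU R n.+2 = 'X *+ 2 * chebyshevU R n.+1 - chebyshevU R n.
Proof. by rewrite -scaler_nat. Qed.

Lemma chebyshevU0 (R : nzRingType) : chebyshevU R 0 = 1.
Proof. by []. Qed.

Lemma chebyshevU1 (R : comNzRingType) : chebyshevU R 1 = 'X *+ 2.
Proof. by rewrite -scaler_nat. Qed.

(** Cassini's identity U_{k+1}^2 - U_k U_{k+2} = 1, with U_{k+2} eliminated by
    the recurrence. *)
Lemma chebyshevU_quadratic (R : comNzRingType) (k : nat) :
  chebyshevU R k ^+ 2 + chebyshevU R k.+1 ^+ 2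
  = 1 + 'X *+ 2 * chebyshevU R k * chebyshevU R k.+1.
Proof.
elim: k => [|k IH]; first by rewrite chebyshevU0 chebyshevU1; ring.
rewrite chebyshevU_rec.
move: (chebyshevU R k) (chebyshevU R k.+1) IH => a b IH.
by rewrite -[1](addrK ('X *+ 2 * a * b)) -IH; ring.
Qed.

Lemma chebyshevU_double (R : comNzRingType) (k : nat) :
  chebyshevU R k.*2.+1
    = chebyshevU R k * (chebyshevU R k.+1 *+ 2 - 'X *+ 2 * chebyshevU R k)
  /\ chebyshevU R k.*2.+2 = chebyshevU R k.+1 ^+ 2 - chebyshevU R k ^+ 2.
Proof.
elim: k => [|k [IH1 IH2]].
  by rewrite double0 chebyshevU_rec chebyshevU0 chebyshevU1; split; ring.
have E : chebyshevU R k.+1.*2.+1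
  = chebyshevU R k.+1
    * (chebyshevU R k.+2 *+ 2 - 'X *+ 2 * chebyshevU R k.+1).
  by rewrite doubleS chebyshevU_rec IH1 IH2 chebyshevU_rec; ring.
split=> //; rewrite chebyshevU_rec E doubleS IH2 chebyshevU_rec; ring.
Qed.

Lemma sum_chebyshevU_even (R : comNzRingType) (k : nat) :
  \sum_(0 <= i < k.*2.+2) chebyshevU R i
  = chebyshevU R k * (chebyshevU R k + chebyshevU R k.+1).
Proof.
elim: k => [|k IH].
  by rewrite double0 2?big_nat_recr //= big_nil chebyshevU0 chebyshevU1; ring.
rewrite big_nat_recr // big_nat_recr //= doubleS IH.
have [_ E2] := chebyshevU_double R k.
have [E3 _] := chebyshevU_double R k.+1.
rewrite doubleS in E3.
rewrite E2 E3 chebyshevU_rec; ring.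
Qed.

Lemma sum_chebyshevU_odd (R : comNzRingType) (k : nat) :
  \sum_(0 <= i < k.*2.+3) chebyshevU R i
  = chebyshevU R k.+1 * (chebyshevU R k + chebyshevU R k.+1).
Proof.
rewrite big_nat_recr //= sum_chebyshevU_even.
have [_ ->] := chebyshevU_double R k; ring.
Qed.

(** * Degrees and leading coefficients *)

Lemma size_coef_chebyshevU (R : comNzRingType) (n : nat) :
  (size (chebyshevU R n) <= n.+1)%N /\ (chebyshevU R n)`_n = 2%:R ^+ n.
Proof.
suff: ((size (chebyshevU R n) <= n.+1)%N /\ (chebyshevU R n)`_n = 2%:R ^+ n)
  /\ ((size (chebyshevU R n.+1) <= n.+2)%N
      /\ (chebyshevU R n.+1)`_n.+1 = 2%:R ^+ n.+1) by case.
elim: n => [|n [[s1 c1] [s2 c2]]].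
  split; first by rewrite chebyshevU0 size_poly1 coef1.
  rewrite chebyshevU1 -scaler_nat.
  split; last by rewrite coefZ coefX mulr1.
  by rewrite (leq_trans (size_scale_leq _ _)) // size_polyX.
do 2!split=> //; rewrite chebyshevU_rec -scaler_nat -scalerAl.
  rewrite (leq_trans (size_polyD _ _)) // size_polyN geq_max.
  apply/andP; split; last by do 2!apply: leqW.
  rewrite (leq_trans (size_scale_leq _ _)) //.
  by rewrite (leq_trans (size_polyMleq _ _)) // size_polyX.
rewrite coefB coefZ coefXM /= c2 -exprS.
by rewrite [_`_n.+2]nth_default ?subr0 // (leq_trans s1).
Qed.

Lemma size_lead_coef_eq (R : nzRingType) (p : {poly R}) (n : nat) (c : R) :
  (size p <= n.+1)%N -> p`_n = c -> c != 0 ->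
  size p = n.+1 /\ lead_coef p = c.
Proof.
move=> sp <- c0; have sE : size p = n.+1.
  apply/eqP; rewrite eqn_leq sp ltnNge.
  by apply: contra c0 => /leq_sizeP ->.
by split=> //; rewrite lead_coefE sE.
Qed.

(** A combination of U_n and a polynomial of smaller degree has the same
    degree and leading coefficient as U_n. *)
Lemma size_lead_coef_chebyshevUD (F : fieldType) (n : nat) (q : {poly F}) :
  2%:R != 0 :> F -> (size q <= n)%N ->
  size (chebyshevU F n + q) = n.+1
  /\ lead_coef (chebyshevU F n + q) = 2%:R ^+ n.
Proof.
move=> c0 sq; have [s1 c1] := size_coef_chebyshevU F n.
apply: size_lead_coef_eq; last exact: expf_neq0.
  by rewrite (leq_trans (size_polyD _ _)) // geq_max s1 leqW.
by rewrite coefD c1 nth_default ?addr0.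
Qed.

Lemma size_sum_chebyshevU (R : comNzRingType) (m : nat) :
  (size (\sum_(0 <= k < m) chebyshevU R k)%R <= m)%N.
Proof.
elim: m => [|m IH]; first by rewrite big_nil size_poly0.
rewrite big_nat_recr //= (leq_trans (size_polyD _ _)) // geq_max leqW //=.
by have [] := size_coef_chebyshevU R m.
Qed.

(** * Resultants as products of values at roots *)

Lemma prodr_const_seq (R : pzSemiRingType) (I : Type) (r : seq I) (x : R) :
  \prod_(i <- r) x = x ^+ size r.
Proof. by rewrite big_const_seq count_predT iter_mulr_1. Qed.

Lemma size_roots_seq (F : closedFieldType) (p : {poly F}) :
  p != 0 -> size (roots_seq p) = (size p).-1.
Proof.
move=> p0; rewrite [in RHS](roots_seqP p) size_scale ?lead_coef_eq0 //.
by rewrite size_prod_XsubC.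
Qed.

Lemma root_roots_seq (F : closedFieldType) (p : {poly F}) (x : F) :
  p != 0 -> x \in roots_seq p -> p.[x] = 0.
Proof.
move=> p0 xp; rewrite (roots_seqP p) hornerZ.
by rewrite -root_prod_XsubC in xp; rewrite (rootP xp) mulr0.
Qed.

Lemma roots_seqM (F : closedFieldType) (p q : {poly F}) :
  p != 0 -> q != 0 -> perm_eq (roots_seq (p * q)) (roots_seq p ++ roots_seq q).
Proof.
move=> p0 q0; rewrite {1}(roots_seqP p) {1}(roots_seqP q).
rewrite -scalerAl -scalerAr scalerA -big_cat.
by apply: roots_seq_perm; rewrite mulf_neq0 ?lead_coef_eq0.
Qed.

Lemma Res_horner (F : closedFieldType) (f g : {poly F}) :
  f != 0 -> g != 0 ->
  Res f g = (-1) ^+ ((size f).-1 * (size g).-1)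
            * lead_coef g ^+ (size f).-1 * \prod_(b <- roots_seq g) f.[b].
Proof.
move=> f0 g0; rewrite /Res exchange_big /=.
have E b : f.[b] = lead_coef f * ((-1) ^+ (size f).-1
                   * \prod_(a <- roots_seq f) (a - b)).
  rewrite {1}(roots_seqP f) hornerZ horner_prod; congr (_ * _).
  rewrite -(size_roots_seq _ f f0) -prodr_const_seq.
  rewrite -big_split /=; apply: eq_bigr => a _.
  by rewrite hornerXsubC mulN1r opprB.
under [in RHS]eq_bigr do rewrite E.
rewrite !big_split /= !prodr_const_seq.
rewrite size_roots_seq // -exprM.
set s := (-1) ^+ _; have s2 : s * s = 1 by rewrite -expr2 sqrr_sign.
move: (\prod_(i <- _) _) (_ ^+ _) (_ ^+ _) => A B C.
by rewrite -[C * B]mul1r -s2; ring.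
Qed.

(** If f is constant on the roots of each of two factors p and q of g, the
    resultant of f and g is explicit. *)
Lemma Res_mul_const (F : closedFieldType) (f p q : {poly F}) (u v : F) :
  f != 0 -> p != 0 -> q != 0 ->
  (forall x, p.[x] = 0 -> f.[x] = u) -> (forall x, q.[x] = 0 -> f.[x] = v) ->
  Res f (p * q) = (-1) ^+ ((size f).-1 * (size (p * q)%R).-1)
    * lead_coef (p * q) ^+ (size f).-1 * (u ^+ (size p).-1 * v ^+ (size q).-1).
Proof.
move=> f0 p0 q0 fp fq; rewrite Res_horner ?mulf_neq0 //; congr (_ * _).
rewrite (perm_big _ (roots_seqM _ _ _ p0 q0)) big_cat /=.
congr (_ * _); rewrite -size_roots_seq // -prodr_const_seq;
  apply: eq_big_seq => x xr.
- by rewrite fp // root_roots_seq.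
- by rewrite fq // root_roots_seq.
Qed.

(** * The resultant of the Chebyshev combinations *)

Lemma sign_half_bin2 (R : pzRingType) (m : nat) :
  (-1) ^+ (m %/ 2) = (-1) ^+ ((m * (m - 1)) %/ 2) :> R.
Proof.
rewrite -[LHS]signr_odd -[RHS]signr_odd; congr (_ ^+ nat_of_bool _).
rewrite -(odd_double_half m); case: (odd m); move: (m./2) => k.
  rewrite add1n subn1 -pred_Sn -muln2 mulnA mulnK // divn2 muln2.
  by rewrite /= uphalf_double oddM /= odd_double.
rewrite add0n divn2 doubleK -muln2 mulnAC mulnK // oddM muln2.
by case: k => // k; rewrite doubleS subn1 /= odd_double andbT.
Qed.

(** The resultant, once S_m is split into factors on whose roots f is 1 and -t
    respectively. *)
Lemma Res_chebyshevU_factors (F : closedFieldType) (t : F) (m : nat)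
    (p q : {poly F}) :
  let f := chebyshevU F m + t *: chebyshevU F (m - 1) in
  let S := \sum_(0 <= i < m) chebyshevU F i in
  2%:R != 0 :> F -> (0 < m)%N ->
  S = p * q -> size q = (m %/ 2).+1 ->
  (forall x, p.[x] = 0 -> f.[x] = 1) -> (forall x, q.[x] = 0 -> f.[x] = - t) ->
  Res f S
  = (-1) ^+ ((m * (m - 1)) %/ 2) * t ^+ (m %/ 2) * 2%:R ^+ (m * (m - 1)).
Proof.
move=> f S two_neq0 hm SE sq fp fq.
have [sf _] : size f = m.+1 /\ lead_coef f = 2%:R ^+ m.
  apply: size_lead_coef_chebyshevUD => //.
  rewrite (leq_trans (size_scale_leq _ _)) // -{2}(subnK hm) addn1.
  by have [] := size_coef_chebyshevU F (m - 1).
have [sS lS] : size S = (m - 1).+1 /\ lead_coef S = 2%:R ^+ (m - 1).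
  rewrite /S; case: (m) hm => // n _.
  rewrite subn1 big_nat_recr //= addrC.
  apply: size_lead_coef_chebyshevUD => //.
  exact: size_sum_chebyshevU.
have f0 : f != 0 by rewrite -size_poly_eq0 sf.
have : S != 0 by rewrite -size_poly_eq0 sS.
rewrite SE mulf_eq0 negb_or => /andP[p0 q0].
rewrite (Res_mul_const _ _ _ _ _ _ f0 p0 q0 fp fq) -SE sf sS lS sq /=.
(* m (m - 1) is even *)
have -> : (-1) ^+ (m * (m - 1)) = 1 :> F.
  rewrite -signr_odd oddM oddB //=.
  by case: (odd m).
by rewrite mul1r expr1n mul1r -exprM [(- t) ^+ _]exprNn sign_half_bin2 mulrC
  [((m - 1) * m)%N]mulnC.
Qed.

Theorem lemma6 (R : realType) (m : nat) (t : R[i]) (hm : (1 <= m)%N) :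
  Res (chebyshevU R[i] m + t *: chebyshevU R[i] (m - 1))
      (\sum_(0 <= k < m) chebyshevU R[i] k)
  = (-1) ^+ ((m * (m - 1)) %/ 2) * t ^+ (m %/ 2) * 2%:R ^+ (m * (m - 1)).
Proof.
have two_neq0 : 2%:R != 0 :> R[i] by rewrite Num.Theory.pnatr_eq0.
have quad k x : (chebyshevU R[i] k).[x] ^+ 2 + (chebyshevU R[i] k.+1).[x] ^+ 2
    - x *+ 2 * (chebyshevU R[i] k).[x] * (chebyshevU R[i] k.+1).[x] = 1.
  have := congr1 (horner^~ x) (chebyshevU_quadratic R[i] k).
  by rewrite !hornerE => ->; rewrite addrK.
have size_U k : size (chebyshevU R[i] k) = k.+1.
  have [] := size_lead_coef_chebyshevUD _ k 0 two_neq0; last by rewrite addr0.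
  by rewrite size_poly0.
have size_UU k : size (chebyshevU R[i] k + chebyshevU R[i] k.+1) = k.+2.
  rewrite addrC; have [] // := size_lead_coef_chebyshevUD _ k.+1
    (chebyshevU R[i] k) two_neq0.
  by rewrite size_U.
have quadUU k x : (chebyshevU R[i] k + chebyshevU R[i] k.+1).[x] = 0 ->
    (chebyshevU R[i] k).[x] = - (chebyshevU R[i] k.+1).[x]
    /\ 2%:R * (1 + x) * (chebyshevU R[i] k.+1).[x] ^+ 2 = 1.
  rewrite hornerD => /eqP; rewrite addr_eq0 => /eqP E; split=> //.
  by rewrite -[RHS](quad k x) E; ring.
have [->|[k [->|->]]] : m = 1%N \/ exists k, m = k.*2.+2 \/ m = k.*2.+3.
- case: m hm => [//|[|m]] _; first by left.
  right; exists m./2; rewrite -{1 3}(odd_double_half m).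
  by case: (odd m); [right | left].
- apply: (Res_chebyshevU_factors _ _ _ 1 1) => //.
  + by rewrite big_nat1 mulr1.
  + by rewrite size_poly1.
  + by move=> x /eqP; rewrite hornerC oner_eq0.
  + by move=> x /eqP; rewrite hornerC oner_eq0.
- have [E1 E2] := chebyshevU_double R[i] k.
  apply: (Res_chebyshevU_factors _ _ _ _ _ two_neq0 _ (sum_chebyshevU_even _ k)).
  + by [].
  + by rewrite size_UU divn2 /= doubleK.
  + move=> x a0; rewrite subn1 /= E1 E2 !hornerE /= -[RHS](quad k x) a0.
    by ring.
  + move=> x /quadUU[ab Q]; rewrite subn1 /= E1 E2 !hornerE /= ab.
    by rewrite -[t in RHS]mulr1 -Q; ring.
- have [_ E2] := chebyshevU_double R[i] k.
  have [E3 _] := chebyshevU_double R[i] k.+1.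
  rewrite chebyshevU_rec doubleS in E3.
  have SE := sum_chebyshevU_odd R[i] k; rewrite mulrC in SE.
  apply: (Res_chebyshevU_factors _ _ _ _ _ two_neq0 _ SE).
  + by [].
  + by rewrite size_U divn2 /= uphalf_double.
  + move=> x /quadUU[ab Q]; rewrite subn1 /= E3 E2 !hornerE /= ab.
    by rewrite -Q; ring.
  + move=> x b0; rewrite subn1 /= E3 E2 !hornerE /= b0.
    by rewrite -[t in RHS]mulr1 -[in RHS](quad k x) b0; ring.
Qed.
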